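(* For $d=(x,y)$ with $x,y\in[-1,1]$ and $\theta\in\mathbb{R}$ let $\ell(\theta;d)=(y-x\theta)^+$. For every $h>0$, there exists a data set $\mathcal{D}=\{d_1,\dots,d_n\}\subseteq[-1,1]^2$ such that the excess risk of the output $\theta^{priv}$ of the objective perturbation algorithm with Huberization parameter $h$ (described in the context) satisfies $$\mathbb{E}\left[\mathcal{L}(\theta^{priv};\mathcal{D})-\mathcal{L}(\theta^*;\mathcal{D})\right]=\Omega\left(\min\left\{n,\max\left\{nh,\tfrac1h\right\}\right\}\right)=\Omega(\sqrt n),$$ where $\mathcal{L}(\theta;\mathcal{D})=\sum_{i=1}^n\ell(\theta;d_i)$ and $\theta^*=\arg\min_{\theta\in[-2,2]}\sum_{i=1}^n\ell(\theta;d_i)$.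
   Context: Here $(z)^+$ equals $z$ when $z>0$ and $0$ otherwise, and the expectation is over the random noise of the algorithm. The numbers $\epsilon,\delta$ are the parameters of $(\epsilon,\delta)$-differential privacy, for which the algorithm below is designed. Huberization: for $h>0$ let $f(z)=(z)^+$ and define $\hat f(z)=f(z)$ when $z<-h$ or $z>h$, and $\hat f(z)=\frac{z^2}{4h}+\frac z2+\frac h4$ for $z\in[-h,h]$. For $d=(x,y)$ set $\hat\ell(\theta;d)=\hat f(y-x\theta)$. Objective perturbation algorithm with Huberization parameter $h$ on $\mathcal{D}=\{d_1,\dots,d_n\}$: draw $b\sim\mathcal{N}\left(0,\frac{8\log(1/\delta)}{\epsilon^2}\right)$ and output $$\theta^{priv}=\arg\min_{\theta\in[-2,2]}\ \sum_{i=1}^n\hat\ell(\theta;d_i)+\frac{\theta^2}{8\epsilon h}+b\theta.$$ *)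

(* Defs.v *)
From HB Require Import structures.
From mathcomp Require Import all_boot all_order all_algebra.
From mathcomp Require Import all_classical all_reals all_analysis.

Set Implicit Arguments.
Unset Strict Implicit.
Unset Printing Implicit Defensive.

Import Order.TTheory GRing.Theory Num.Theory.

Local Open Scope classical_set_scope.
Local Open Scope ring_scope.

Section objective_perturbation.
Context {R : realType}.
Implicit Types (z theta h eps delta b : R) (d : R * R).

Definition pos_part z : R := Num.max z 0.

(* A data point d is the pair (x, y). *)
Definition loss theta d : R := pos_part (d.2 - d.1 * theta).

Definition huber h z : R :=
  if (z < - h) || (h < z) then pos_part z
  else z ^+ 2 / (4 * h) + z / 2 + h / 4.

Definition huber_loss h theta d : R := huber h (d.2 - d.1 * theta).

(* A data set is a sequence of n points, so points may be repeated. *)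
Definition total_loss (n : nat) (D : n.-tuple (R * R)) theta : R :=
  \sum_(i < n) loss theta (tnth D i).

Definition minimizers (S : set R) (g : R -> R) : set R :=
  [set t | S t /\ forall u, S u -> g t <= g u].

(* Some minimizer of g over S; the junk value 0 is returned only when the
   minimum is not attained.  Below, S is the compact interval [-2, 2] and g is
   continuous, so a minimizer exists. *)
Definition argmin (S : set R) (g : R -> R) : R := xget 0 (minimizers S g).

Definition perturbed_objective (n : nat) (D : n.-tuple (R * R)) eps h b theta : R :=
  \sum_(i < n) huber_loss h theta (tnth D i)
  + theta ^+ 2 / (8 * eps * h) + b * theta.

(* The output of the algorithm when the noise takes the value b. *)
Definition theta_priv (n : nat) (D : n.-tuple (R * R)) eps h b : R :=
  argmin `[-2, 2] (perturbed_objective D eps h b).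

Definition theta_star (n : nat) (D : n.-tuple (R * R)) : R :=
  argmin `[-2, 2] (total_loss D).

Definition noise_variance eps delta : R := 8 * ln (1 / delta) / eps ^+ 2.

(* normal_prob takes the standard deviation, not the variance. *)
Definition noise_law eps delta : probability (measurableTypeR R) R :=
  normal_prob 0 (Num.sqrt (noise_variance eps delta)).

(* An extended real, as is every expectation; the random variable is
   nonnegative and bounded. *)
Definition expected_excess_risk (n : nat) (D : n.-tuple (R * R)) eps delta h : \bar R :=
  ('E_(noise_law eps delta)
    [fun b => (total_loss D (theta_priv D eps h b) - total_loss D (theta_star D))%R])%E.

Definition risk_rate (n : nat) h : R :=
  Num.min n%:R (Num.max (n%:R * h) (1 / h)).

End objective_perturbation.

(* Main.v *)
Require Import Defs.
From HB Require Import structures.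
From mathcomp Require Import all_boot all_order all_algebra.
From mathcomp Require Import all_classical all_reals all_analysis.
From mathcomp Require Import measurable_realfun ring lra.

Import Order.TTheory GRing.Theory Num.Theory.
Import numFieldNormedType.Exports HBNNSimple.

Local Open Scope classical_set_scope.
Local Open Scope ring_scope.

(** Both data sets are fitted exactly by theta = 1, so the excess risk is just
    the total loss of the output, and it suffices to bound that loss on the
    event 1 <= b <= 2, whose probability is a positive constant.  On this event
    the noise and the regularizer both push the output to the left of 1.

    If 1/h dominates, all points are (s, s), with s chosen so that the total
    slope n s of the loss is at most 1/(8 eps h); the regularizer alone then
    keeps the output below 1/2, at a cost of n s / 2.

    If n h dominates, half of the points are (-1, -1), with loss
    (theta - 1)^+, and half are (1/2, 1/2), with loss (1 - theta)^+ / 2.  The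
    Huberized losses trade the kink at 1 for a smooth minimum at distance of
    order h to the left of 1, which costs order n h. *)

(* Needed because [ge0_le_integral] requires measurable integrands, whereas the
   output is picked by choice among minimizers, for each value of the noise. *)
Lemma ge0_integral_ge_measure d (T : measurableType d) (R : realType)
    (mu : {measure set T -> \bar R}) (f : T -> \bar R) (A : set T) (c : R) :
  (forall x, (0 <= f x)%E) -> measurable A -> 0 <= c ->
  (forall x, A x -> (c%:E <= f x)%E) ->
  (c%:E * mu A <= \int[mu]_x f x)%E.
Proof.
move=> f0 mA c0 cf.
rewrite ge0_integralTE//.
(* The integral is a supremum over nonnegative simple functions below [f], and [c] times the
   indicator of [A] is one of them. *)
apply: ereal_sup_ubound => /=.
exists (scale_nnsfun (indic_nnsfun R mA) c0) => [x|].
  rewrite (_ : scale_nnsfun _ _ x = c * \1_A x)// indicE.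
  have [xA|xA] := boolP (x \in A); last by rewrite mulr0.
  by rewrite mulr1; exact: cf (set_mem xA).
by rewrite sintegralrM// sintegral_indic.
Qed.

(** * The Huberized hinge: convexity, Lipschitz bound, continuity *)

Lemma huberE (R : realType) (h z : R) : 0 < h ->
  huber h z = (if z < - h then 0 else if h < z then z else (z + h) ^+ 2 / (4 * h)).
Proof.
move=> h0; rewrite /huber /pos_part.
case: (ltP z (- h)) => zh /=; first by apply/max_idPr; lra.
case: (ltP h z) => hz /=; first by apply/max_idPl; lra.
by field; rewrite gt_eqF.
Qed.

(** By convexity; on the quadratic zone the gap is exactly [(z - w) ^+ 2 / (4 * h)]. *)
Lemma huber_tangent (R : realType) (h w z : R) : 0 < h -> - h <= w <= h ->
  huber h w + (w + h) / (2 * h) * (z - w) <= huber h z.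
Proof.
move=> h0 /andP[hw wh]; rewrite !huberE//.
rewrite (ltNge w) hw (ltNge h) wh /=.
have -> : (w + h) ^+ 2 / (4 * h) + (w + h) / (2 * h) * (z - w) =
  (w + h) * (h - w + 2 * z) / (4 * h) by field; rewrite gt_eqF.
have h4 : 0 < 4 * h by lra.
case: (ltP z (- h)) => zh /=; first by rewrite ler_pdivrMr//; nra.
case: (ltP h z) => hz /=; first by rewrite ler_pdivrMr//; nra.
rewrite ler_pM2r ?invr_gt0//; have := sqr_ge0 (z - w); lra.
Qed.

(** The tangents at [- h] and [h] are zero and the identity, which settles [z] outside the quadratic
    zone; inside it, the tangent at [z] has slope in [0, 1]. *)
Lemma huber_lipschitz (R : realType) (h z w : R) : 0 < h ->
  huber h z - huber h w <= `|z - w|.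
Proof.
move=> h0.
have w0 : 0 <= huber h w.
  have := @huber_tangent R h (- h) w h0.
  rewrite [huber h (- h)]huberE// ltxx (_ : h < - h = false); last by apply/negbTE; lra.
  by rewrite addNr expr0n /= !mul0r addr0; apply; lra.
have hw : w <= huber h w.
  have := @huber_tangent R h h w h0.
  rewrite [huber h h]huberE// ltxx (_ : h < - h = false); last by apply/negbTE; lra.
  have -> : (h + h) ^+ 2 / (4 * h) + (h + h) / (2 * h) * (w - h) = w.
    by field; rewrite gt_eqF.
  by apply; lra.
rewrite [huber h z]huberE//.
case: (ltP z (- h)) => zh; first by rewrite (le_trans _ (normr_ge0 _))//; lra.
case: (ltP h z) => hz; first by rewrite (le_trans _ (ler_norm _))//; lra.
have := @huber_tangent R h z w h0; rewrite zh hz => /(_ isT).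
rewrite [huber h z]huberE// ltNge zh /= ltNge hz /=.
set c := (z + h) / (2 * h) => H.
have c0 : 0 <= c by rewrite divr_ge0//; lra.
have c1 : c <= 1 by rewrite ler_pdivrMr; lra.
have := ler_norm (z - w); have := normr_ge0 (z - w); nra.
Qed.

Lemma continuous_huber (R : realType) (h : R) : 0 < h -> continuous (huber h).
Proof.
move=> h0 z; apply/cvgrPdist_le => e e0; near=> w.
have zw : `|z - w| <= e by near: w; exact: cvgr_dist_le.
apply: le_trans zw; rewrite ler_norml huber_lipschitz// andbT lerNl opprB distrC.
exact: huber_lipschitz.
Unshelve. all: by end_near. Qed.

(** * Existence and values of the minimizers *)

Lemma continuous_perturbed_objective (R : realType) (n : nat)
    (D : n.-tuple (R * R)) (eps h b : R) :
  0 < h -> continuous (perturbed_objective D eps h b).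
Proof.
move=> h0 x; rewrite /perturbed_objective.
apply: cvgD; last by apply: cvgM; [exact: cvg_cst|exact: cvg_id].
apply: cvgD; last by apply: cvgM; [exact: exprn_continuous|exact: cvg_cst].
apply: cvg_big => [|i _]; first exact: add_continuous.
apply: (cvg_comp (fun t => (tnth D i).2 - (tnth D i).1 * t) (huber h)).
  apply: cvgB; first exact: cvg_cst.
  by apply: cvgM; [exact: cvg_cst|exact: cvg_id].
exact: continuous_huber.
Qed.

(** Continuity on a compact interval rules out the default value of [argmin]. *)
Lemma theta_priv_minimizer (R : realType) (n : nat)
    (D : n.-tuple (R * R)) (eps h b : R) : 0 < h ->
  minimizers `[-2, 2] (perturbed_objective D eps h b) (theta_priv D eps h b).
Proof.
move=> h0; rewrite /theta_priv /argmin; apply: xgetPex.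
have [||c cI cmin] := @EVT_min R (perturbed_objective D eps h b) (-2) 2.
- by lra.
- exact/continuous_subspaceT/continuous_perturbed_objective.
- by exists c; split.
Qed.

Lemma total_loss_ge0 (R : realType) (n : nat) (D : n.-tuple (R * R)) (t : R) :
  0 <= total_loss D t.
Proof. by apply: sumr_ge0 => i _; rewrite /loss /pos_part le_max lexx orbT. Qed.

(** Losses are nonnegative, so 1 is a minimizer; [theta_star] may be another one, but with the same
    loss. *)
Lemma total_loss_theta_star (R : realType) (n : nat) (D : n.-tuple (R * R)) :
  total_loss D 1 = 0 -> total_loss D (theta_star D) = 0.
Proof.
move=> D1.
have [] : minimizers `[-2, 2] (total_loss D) (theta_star D).
  rewrite /theta_star /argmin; apply: xgetPex; exists 1; split.
    by rewrite /= in_itv /=; lra.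
  by move=> u _; rewrite D1 total_loss_ge0.
move=> _ /(_ 1); rewrite D1 => Hle; apply/eqP; rewrite eq_le total_loss_ge0 andbT.
by apply: Hle; rewrite /= in_itv /=; lra.
Qed.

(** * From noise values to the expected risk *)

(** On [1, 2], an interval of length 1, the centred Gaussian density is smallest at 2. *)
Lemma noise_law_itv12_ge (R : realType) (eps delta : R) :
  0 < eps -> 0 < delta < 1 ->
  let p := normal_pdf 0 (Num.sqrt (noise_variance eps delta)) 2 in
  0 < p /\ (p%:E <= noise_law eps delta `[1%R, 2%R]%classic)%E.
Proof.
move=> e0 /andP[d0 d1].
have v0 : 0 < noise_variance eps delta.
  rewrite /noise_variance divr_gt0 ?exprn_gt0// mulr_gt0// ln_gt0//.
  by rewrite ltr_pdivlMr// mul1r.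
set s := Num.sqrt _.
have s0 : 0 < s by rewrite sqrtr_gt0.
have sN0 : s != 0 by rewrite gt_eqF.
split; first by rewrite normal_pdfE// mulr_gt0 ?normal_peak_gt0// expR_gt0.
rewrite /= /noise_law -/s /normal_prob.
have -> : (normal_pdf 0 s 2)%:E =
    (\int[lebesgue_measure]_(x in `[1%R, 2%R]) (cst (normal_pdf 0 s 2)%:E) x)%E.
  rewrite integral_cst//= lebesgue_measure_itv /= lte_fin ltr1n -EFinB.
  by rewrite -EFinM; congr EFin; ring.
apply: ge0_le_integral => //=.
- by move=> x _; rewrite lee_fin normal_pdf_ge0.
- by apply/measurable_EFinP; apply: measurable_funTS; exact: measurable_normal_pdf.
- move=> x; rewrite in_itv /= => /andP[x1 x2].
  rewrite lee_fin normal_pdfE// ler_wpM2l ?normal_peak_ge0// ler_expR.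
  rewrite !subr0 ler_wpM2r ?invr_ge0 ?mulrn_wge0 ?sqr_ge0// lerN2.
  by nra.
Qed.

Lemma expected_excess_risk_ge (R : realType) (n : nat) (D : n.-tuple (R * R))
    (eps delta h v : R) : 0 < eps -> 0 < delta < 1 -> 0 <= v ->
  total_loss D 1 = 0 ->
  (forall b, 1 <= b -> v <= total_loss D (theta_priv D eps h b)) ->
  ((normal_pdf 0 (Num.sqrt (noise_variance eps delta)) 2 * v)%:E
    <= expected_excess_risk D eps delta h)%E.
Proof.
move=> e0 d01 v0 D1 Dv; have [p0 pP] := @noise_law_itv12_ge R _ _ e0 d01.
rewrite /expected_excess_risk unlock.
apply: (@le_trans _ _ (v%:E * noise_law eps delta `[1%R, 2%R]%classic)%E).
  by rewrite mulrC EFinM lee_wpmul2l// lee_fin.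
apply: ge0_integral_ge_measure => //.
- by move=> x; rewrite total_loss_theta_star// subr0 lee_fin total_loss_ge0.
- move=> b; rewrite /= in_itv /= => /andP[b1 _].
  by rewrite total_loss_theta_star// subr0 lee_fin Dv.
Qed.

(** * Small h: bias from the regularizer *)

(** The cap at 1 keeps the points in the square when [1 / (8 * eps * h)] exceeds [n]. *)
Definition diag_scale {R : realType} (n : nat) (eps h : R) : R :=
  Num.min 1 (1 / (8 * eps * h) / n%:R).

Definition diag_data {R : realType} (n : nat) (eps h : R) : n.-tuple (R * R) :=
  [tuple (diag_scale n eps h, diag_scale n eps h) | i < n].

Lemma regularization_bias (R : realType) (n : nat) (eps h b : R) :
  (0 < n)%N -> 0 < eps -> 0 < h -> 1 <= b ->
  n%:R * diag_scale n eps h / 2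
    <= total_loss (diag_data n eps h) (theta_priv (diag_data n eps h) eps h b).
Proof.
move=> n0 e0 h0 b1; rewrite /diag_data.
set s := diag_scale n eps h; set D := [tuple _ | _ < n].
have n0R : 0 < n%:R :> R by rewrite ltr0n.
have [_ tmin] := @theta_priv_minimizer R n D eps h b h0.
set t := theta_priv _ _ _ _ in tmin *.
pose K := 1 / (8 * eps * h).
have K0 : 0 < K by rewrite divr_gt0// !mulr_gt0.
have s0 : 0 < s by rewrite lt_min ltr01 divr_gt0.
have nsK : n%:R * s <= K.
  by rewrite mulrC -ler_pdivlMr// ge_min lexx orbT.
have FE x : perturbed_objective D eps h b x =
    n%:R * huber h (s - s * x) + x ^+ 2 * K + b * x.
  rewrite /perturbed_objective; under eq_bigr do rewrite tnth_mktuple.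
  by rewrite /huber_loss /= sumr_const card_ord -[in LHS](mulr_natl _ n) /K mul1r.
have LE x : total_loss D x = n%:R * pos_part (s - s * x).
  rewrite /total_loss; under eq_bigr do rewrite tnth_mktuple.
  by rewrite /loss /= sumr_const card_ord -[in LHS](mulr_natl _ n).
have t12 : t <= 1 / 2.
  rewrite leNgt; apply/negP => t12.
  have : perturbed_objective D eps h b t <= perturbed_objective D eps h b (1 / 2).
    by apply: tmin; rewrite /= in_itv /=; lra.
  have := @huber_lipschitz R h (s - s * (1 / 2)) (s - s * t) h0.
  rewrite !FE ger0_norm; last by nra.
  move=> Hl; have {Hl} := ler_wpM2l (ltW n0R) Hl.
  set a := huber _ _; set a' := huber _ _ => Hl Hm.
  have d0 : 0 < t - 1 / 2 by lra.
  (* From 1/2 to [t] the regularizer grows by [K * (t - 1 / 2)], which pays for the drop of the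
     losses, plus this square; the noise term makes the total growth strict. *)
  have := mulr_ge0 (ltW K0) (sqr_ge0 (t - 1 / 2)).
  have : n%:R * s * (t - 1 / 2) <= K * (t - 1 / 2) by rewrite ler_wpM2r// ltW.
  have : t - 1 / 2 <= b * (t - 1 / 2) by rewrite ler_peMl// ltW.
  lra.
rewrite LE -mulrA ler_wpM2l ?ler0n// /pos_part le_max; apply/orP; left.
by nra.
Qed.

(** * Large h: bias from Huberization *)

Lemma sum_parity (V : nmodType) (n : nat) (a c : V) :
  \sum_(i < n) (if odd i then a else c) = a *+ n./2 + c *+ uphalf n.
Proof.
elim: n => [|n IHn]; first by rewrite big_ord0 addr0.
rewrite big_ord_recr /= IHn uphalf_half mulrS.
case: (odd n); rewrite ?add1n ?add0n ?mulrS.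
  by rewrite addrC addrA.
by rewrite -addrA (addrC c).
Qed.

Definition kink_data {R : realType} (n : nat) : n.-tuple (R * R) :=
  [tuple (if odd i then (-1, -1) else (1 / 2, 1 / 2)) | i < n].

(* At 1 - u, the Huberized losses of (-1, -1) and (1/2, 1/2) have slopes at
   least 3/8 and at least -9/32.  For odd n there is one more point (1/2, 1/2)
   than (-1, -1); its slope is absorbed by the noise b >= 1. *)
Lemma huberization_bias (R : realType) (n : nat) (eps h b : R) :
  0 < eps -> 0 < h -> 1 <= b ->
  n%:R * Num.min h 1 / 16
    <= total_loss (kink_data n) (theta_priv (kink_data n) eps h b).
Proof.
move=> e0 h0 b1; rewrite /kink_data; set D := [tuple _ | _ < n].
have [_ tmin] := @theta_priv_minimizer R n D eps h b h0.
set t := theta_priv _ _ _ _ in tmin *.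
(* The residuals at [1 - u] are [- u] and [u / 2]; [u <= h / 4] puts them in the quadratic zone and
   yields the slope bounds, and [u <= 1 / 4] keeps [1 - u] in [-2, 2]. *)
set u := Num.min h 1 / 4.
have u0 : 0 < u by rewrite divr_gt0// lt_min h0 ltr01.
have uh : u <= h / 4 by rewrite ler_pM2r ?invr_gt0// ge_min lexx.
have u1 : u <= 1 / 4 by rewrite ler_pM2r ?invr_gt0// ge_min lexx orbT.
have up1 : (uphalf n <= n./2.+1)%N.
  by rewrite uphalf_half -add1n leq_add2r leq_b1.
have up2 : (n <= (uphalf n).*2)%N.
  by rewrite uphalf_half doubleD -{1}(odd_double_half n) leq_add2r; case: (odd n).
have tu : t <= 1 - u.
  rewrite leNgt; apply/negP => tu.
  have : perturbed_objective D eps h b t <= perturbed_objective D eps h b (1 - u).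
    by apply: tmin; rewrite /= in_itv /=; lra.
  apply/negP; rewrite -ltNge -subr_gt0 /perturbed_objective.
  set S := \sum_(i < n) huber_loss h t _; set S' := \sum_(i < n) huber_loss h _ _.
  pose d := t - (1 - u).
  have d0 : 0 < d by rewrite /d; lra.
  have SS : d * (3 / 8) *+ n./2 + (- d * (9 / 32)) *+ uphalf n <= S - S'.
    rewrite -sum_parity -sumrB; apply: ler_sum => i _.
    rewrite /huber_loss tnth_mktuple; case: (odd i) => /=.
      have wh : - h <= -1 - -1 * (1 - u) <= h by lra.
      have := huber_tangent _ _ _ (-1 - -1 * t) h0 wh.
      set k := _ / (2 * h).
      have : 3 / 8 <= k by rewrite ler_pdivlMr; lra.
      by move=> /(ler_wpM2r (ltW d0)); rewrite /d; lra.
    have wh : - h <= 1 / 2 - 1 / 2 * (1 - u) <= h by lra.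
    have := huber_tangent _ _ _ (1 / 2 - 1 / 2 * t) h0 wh.
    set k := _ / (2 * h).
    have : k <= 9 / 16 by rewrite ler_pdivrMr; lra.
    by move=> /(ler_wpM2r (ltW d0)); rewrite /d; lra.
  (* This gain of [d] exceeds the [9 / 32 * d] lost on an unpaired point. *)
  have db : d <= b * t - b * (1 - u) by rewrite -mulrBr ler_peMl// ltW.
  have : 0 < t ^+ 2 / (8 * eps * h) - (1 - u) ^+ 2 / (8 * eps * h).
    rewrite -mulrBl divr_gt0 ?mulr_gt0// subr_sqr mulr_gt0//; lra.
  have up1d : (uphalf n)%:R * d <= ((n./2)%:R + 1) * d.
    by rewrite ler_wpM2r ?(ltW d0)// natr1 ler_nat.
  have n20 : 0 <= (n./2)%:R * d by rewrite mulr_ge0 ?ler0n// ltW.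
  move: SS; rewrite -[X in X + _ <= _]mulr_natr -[X in _ + X <= _]mulr_natr.
  set X := t ^+ 2 / _; set Y := (1 - u) ^+ 2 / _.
  by clearbody d S S' X Y; lra.
(* Only the points (1/2, 1/2), at least half of all, are counted, whence the constant 1/16. *)
have LE : (u / 2) * (uphalf n)%:R <= total_loss D t.
  have -> : u / 2 * (uphalf n)%:R = \sum_(i < n) (if odd i then 0 else u / 2).
    by rewrite sum_parity mul0rn add0r mulr_natr.
  apply: ler_sum => i _; rewrite /loss tnth_mktuple /pos_part le_max.
  by case: (odd i) => /=; apply/orP; [right|left; lra].
have : n%:R <= 2 * (uphalf n)%:R :> R by rewrite -natrM mul2n ler_nat.
move: LE; rewrite (_ : Num.min h 1 = 4 * u); last by rewrite /u; field.
nra.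
Qed.

(** * The rate and the choice of the data set *)

(** The product of [n h] and [1 / h] is [n], so one of them is at least the square root of [n]. *)
Lemma sqrt_le_risk_rate (R : realType) (n : nat) (h : R) :
  (0 < n)%N -> 0 < h -> Num.sqrt n%:R <= risk_rate n h.
Proof.
move=> n0 h0; have n1 : 1 <= n%:R :> R by rewrite ler1n.
set r := Num.sqrt _.
have r0 : 0 <= r by exact: sqrtr_ge0.
have rr : r * r = n%:R by rewrite -expr2 sqr_sqrtr// ler0n.
have r1 : 1 <= r by rewrite leNgt; apply/negP => r1; nra.
rewrite /risk_rate le_min le_max -rr; apply/andP; split; first by nra.
case: (leP 1 (r * h)) => rh; apply/orP; [left; nra|right].
by rewrite ler_pdivlMr//; lra.
Qed.

Theorem theoremA1 (R : realType) (eps delta : R)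
    (eps_gt0 : 0 < eps) (delta_gt0 : 0 < delta) (delta_lt1 : delta < 1) :
  exists c1 c2 : R, [/\ 0 < c1, 0 < c2 &
    forall (n : nat) (h : R), (0 < n)%N -> 0 < h ->
      c2 * Num.sqrt n%:R <= c1 * risk_rate n h /\
      exists D : n.-tuple (R * R),
        (forall i : 'I_n, -1 <= (tnth D i).1 <= 1 /\ -1 <= (tnth D i).2 <= 1) /\
        ((c1 * risk_rate n h)%:E <= expected_excess_risk D eps delta h)%E].
Proof.
have d01 : 0 < delta < 1 by rewrite delta_gt0.
have [p0 _] := @noise_law_itv12_ge R eps delta eps_gt0 d01.
pose p := normal_pdf 0 (Num.sqrt (noise_variance eps delta)) 2.
(* 1/16 comes from [huberization_bias] and also covers the capped [diag_scale], with bound [n / 2];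
   the uncapped scale gives exactly [1 / (16 * eps * h)]. *)
pose k := Num.min (1 / 16) (1 / (16 * eps)).
have k0 : 0 < k by rewrite lt_min !divr_gt0 ?mulr_gt0.
have k16 : k <= 1 / 16 by rewrite ge_min lexx.
have ke : k <= 1 / (16 * eps) by rewrite ge_min lexx orbT.
have pk0 : 0 < p * k by rewrite mulr_gt0.
exists (p * k), (p * k); split=> // n h n0 h0; split.
  by rewrite ler_pM2l// sqrt_le_risk_rate.
have n0R : 0 < n%:R :> R by rewrite ltr0n.
have rate0 : 0 <= risk_rate n h.
  exact: le_trans (sqrtr_ge0 _) (sqrt_le_risk_rate _ _ _ n0 h0).
suff [D [v [Dd D1 v0 Dv kv]]] : exists (D : n.-tuple (R * R)) v,
  [/\ forall i : 'I_n, -1 <= (tnth D i).1 <= 1 /\ -1 <= (tnth D i).2 <= 1,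
    total_loss D 1 = 0, 0 <= v,
    forall b, 1 <= b -> v <= total_loss D (theta_priv D eps h b) &
    k * risk_rate n h <= v].
  exists D; split=> //.
  apply: le_trans (expected_excess_risk_ge _ _ _ _ _ _ _ eps_gt0 d01 v0 D1 Dv).
  by rewrite lee_fin -mulrA ler_pM2l.
case: (leP (1 / h) (n%:R * h)) => hn.
  exists (kink_data n).
  exists (n%:R * Num.min h 1 / 16); split.
  - by move=> i; rewrite tnth_mktuple; case: (odd i) => /=; lra.
  - rewrite /total_loss big1// => i _; rewrite tnth_mktuple /loss.
    by case: (odd i) => /=; apply/max_idPr; lra.
  - by rewrite divr_ge0// mulr_ge0// le_min ltW/=.
  - by move=> b b1; exact: huberization_bias.
  (* Here the rate is at most both [n] and [n h], hence at most [n * min(h, 1)]. *)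
  - have := rate0; have := ler_wpM2r rate0 k16.
    have : risk_rate n h <= n%:R by rewrite /risk_rate ge_min lexx.
    have : risk_rate n h <= n%:R * h by rewrite /risk_rate max_l// ge_min lexx orbT.
    by case: (leP h 1) => _; lra.
set s := diag_scale n eps h.
have K0 : 0 < 1 / (8 * eps * h) by rewrite divr_gt0// !mulr_gt0.
have s0 : 0 < s by rewrite lt_min ltr01 divr_gt0.
have s1 : s <= 1 by rewrite ge_min lexx.
exists (diag_data n eps h), (n%:R * s / 2); split.
- by move=> i; rewrite tnth_mktuple /= -/s; lra.
- rewrite /total_loss big1// => i _; rewrite tnth_mktuple /loss /= -/s.
  by apply/max_idPr; lra.
- by rewrite divr_ge0// mulr_ge0// ltW.
- by move=> b b1; exact: regularization_bias.
- have rate_n : risk_rate n h <= n%:R by rewrite /risk_rate ge_min lexx.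
  have rate_h : risk_rate n h <= 1 / h.
    by rewrite /risk_rate max_r ?(ltW hn)// ge_min lexx orbT.
  rewrite /s /diag_scale; case: (leP 1 _) => _.
    by have := ler_wpM2r rate0 k16; lra.
  have -> : n%:R * (1 / (8 * eps * h) / n%:R) / 2 = 1 / (16 * eps) * (1 / h).
    by field; rewrite !gt_eqF.
  by apply: ler_pM => //; exact: ltW.
Qed.
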